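(* Let $d\ge 2$, let $A,B$ be Hermitian $d\times d$ complex matrices, and let $\rho$ be a density matrix on $\mathbb{C}^d$ with smallest and second-smallest eigenvalues $\lambda_1\le\lambda_2$ (counted with multiplicity). Then $$V_\rho(A)\,V_\rho(B)\;\ge\;\frac14\bigl|\langle [A,B]\rangle_\rho\bigr|^2+\mathrm{Cov}_\rho(A,B)^2+\frac{\lambda_1\lambda_2}{\lambda_1+\lambda_2}\,\bigl\langle |[A,B]|^2\bigr\rangle_\rho ,$$ where the last term is understood to be $0$ if $\lambda_1=0$. Moreover, the coefficient is optimal: for every strictly positive density matrix $\rho$ on $\mathbb{C}^d$, the number $\frac{\lambda_1\lambda_2}{\lambda_1+\lambda_2}$ is the largest real constant $b$ such that $$V_\rho(A)\,V_\rho(B)\ge\frac14|\langle [A,B]\rangle_\rho|^2+\mathrm{Cov}_\rho(A,B)^2+b\,\langle |[A,B]|^2\rangle_\rho$$ holds for all Hermitian $d\times d$ matrices $A,B$.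
   Context: A density matrix on $\mathbb{C}^d$ is a positive semidefinite $d\times d$ complex matrix of trace $1$. For a matrix $X$, $\langle X\rangle_\rho:=\mathrm{Tr}(X\rho)$. For Hermitian $X$, $V_\rho(X):=\mathrm{Tr}\bigl((X-\langle X\rangle_\rho\mathbb{I})^2\rho\bigr)$. Also $[A,B]:=AB-BA$, $\{A,B\}:=AB+BA$, $\mathrm{Cov}_\rho(A,B):=\tfrac12\langle\{A,B\}\rangle_\rho-\langle A\rangle_\rho\langle B\rangle_\rho$, and $|[A,B]|^2:=[A,B]^\dagger[A,B]$. *)

(* Defs.v *)
From mathcomp Require Export all_boot all_order all_algebra.
From mathcomp Require Export complex reals.

Set Implicit Arguments.
Unset Strict Implicit.
Unset Printing Implicit Defensive.

Import Order.TTheory GRing.Theory Num.Theory.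
Local Open Scope ring_scope.
Local Open Scope complex_scope.
Local Open Scope sesquilinear_scope.

(* All scalars below live in R[i], whose order is the partial one:
   x <= y means that y - x is a nonnegative real. An inequality in R[i]
   therefore carries the fact that y - x is real. *)

Definition psdmx (R : realType) (d : nat) (X : 'M[R[i]]_d) : Prop :=
  X \is hermsymmx /\ forall u : 'cV[R[i]]_d, 0 <= (u ^t* *m X *m u) 0 0.

Definition pdmx (R : realType) (d : nat) (X : 'M[R[i]]_d) : Prop :=
  X \is hermsymmx /\
  forall u : 'cV[R[i]]_d, u != 0 -> 0 < (u ^t* *m X *m u) 0 0.

Definition density (R : realType) (d : nat) (rho : 'M[R[i]]_d) : Prop :=
  psdmx rho /\ \tr rho = 1.

Definition expect (R : realType) (d : nat) (rho X : 'M[R[i]]_d) : R[i] :=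
  \tr (X *m rho).

Definition variance (R : realType) (d : nat) (rho X : 'M[R[i]]_d) : R[i] :=
  let Y := X - (expect rho X)%:M in \tr (Y *m Y *m rho).

Definition commmx (R : realType) (d : nat) (A B : 'M[R[i]]_d) : 'M[R[i]]_d :=
  A *m B - B *m A.

Definition acommmx (R : realType) (d : nat) (A B : 'M[R[i]]_d) : 'M[R[i]]_d :=
  A *m B + B *m A.

Definition covariance (R : realType) (d : nat) (rho A B : 'M[R[i]]_d) : R[i] :=
  2^-1 * expect rho (acommmx A B) - expect rho A * expect rho B.

Definition sqabsmx (R : realType) (d : nat) (X : 'M[R[i]]_d) : 'M[R[i]]_d :=
  X ^t* *m X.

(* The roots of the characteristic polynomial, with multiplicity, in
   nondecreasing order. Only meant for Hermitian X: its eigenvalues are real,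
   so that taking real parts merely moves them from R[i] to R. *)
Definition eigenvalues (R : realType) (d : nat) (X : 'M[R[i]]_d) : seq R :=
  sort <=%R
    [seq complex.Re z | z <- sval (closed_field_poly_normal (char_poly X))].

Definition lambda1 (R : realType) (d : nat) (X : 'M[R[i]]_d) : R :=
  (eigenvalues X)`_0.

Definition lambda2 (R : realType) (d : nat) (X : 'M[R[i]]_d) : R :=
  (eigenvalues X)`_1.

(* This is 0 when lambda1 rho = 0, also when lambda2 rho = 0 as well, since
   0 / 0 = 0. *)
Definition uncertainty_coef (R : realType) (d : nat) (rho : 'M[R[i]]_d) : R :=
  lambda1 rho * lambda2 rho / (lambda1 rho + lambda2 rho).

Definition uncertainty_bound (R : realType) (d : nat) (rho : 'M[R[i]]_d)
    (b : R) (A B : 'M[R[i]]_d) : Prop :=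
  4^-1 * `|expect rho (commmx A B)| ^+ 2 + covariance rho A B ^+ 2
    + b%:C * expect rho (sqabsmx (commmx A B))
  <= variance rho A * variance rho B.

(* Main.v *)
Require Import Defs.
From mathcomp Require Import ring lra.
Set Implicit Arguments.
Unset Strict Implicit.
Unset Printing Implicit Defensive.
Import Order.TTheory GRing.Theory Num.Theory.
Local Open Scope ring_scope.
Local Open Scope complex_scope.
Local Open Scope sesquilinear_scope.

(* Centring A and B turns the claim into a lower bound on the Gram determinant
   tr(A^2 rho) tr(B^2 rho) - |tr(A B rho)|^2. Write rho = T^* T and C = [A, B].
   The contributions to tr(A B rho) of the rows of T A and T B are the diagonal
   entries x_k of T A B T^*, and x_k - conj x_k is the k-th diagonal entry of
   T C T^*. Conjugating the rows with Im x_k < 0 before applying Cauchy-Schwarz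
   shows that the Gram determinant is at least
   (sum |Im x_k|)^2 - (sum Im x_k)^2.
   When rho > 0, T can be chosen so that T C T^* is diagonal: with rho = U^* D U,
   take T = V sqrt(D) U, where V diagonalizes sqrt(D) U C U^* sqrt(D). Then, with
   s_k = (V D^-1 V^* )_kk, one has tr(C) = 2 i sum s_k Im x_k, which is 0, and
   tr(C^* C rho) = 4 sum s_k (Im x_k)^2. By Ky Fan,
   s_j + s_k <= 1/lambda1 + 1/lambda2 for j <> k, and the bound becomes an
   inequality between real sums. *)

(** * Inequalities for finite sums *)

(* Splitting [n] into its positive part [P] and negative part [Q], the left-hand
   side is at most [4 k (x + y)] with [x = \sum P], [y = \sum Q] and
   [k = \sum P s = \sum Q s], and
   [k (x + y) = \sum_(i, j) P i * Q j * (s i + s j)]. *)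
Lemma weighted_sum_sqr_le (F : realFieldType) (I : finType) (K : F)
    (n s : I -> F) :
  (forall i, 0 <= s i) -> (forall i j, i != j -> s i + s j <= K) ->
  \sum_i n i * s i = 0 ->
  4 * (\sum_i n i ^+ 2 * s i) <= K * ((\sum_i `|n i|) ^+ 2 - (\sum_i n i) ^+ 2).
Proof.
move=> s_ge0 sK ns0.
pose P i := Num.max (n i) 0; pose Q i := Num.max (- n i) 0.
have P0 i : 0 <= P i by rewrite le_max lexx orbT.
have Q0 i : 0 <= Q i by rewrite le_max lexx orbT.
have PQ i : [/\ n i = P i - Q i, `|n i| = P i + Q i & P i * Q i = 0].
  rewrite /P /Q; case: (lerP (n i) 0) => [n0|n0].
    by rewrite max_l ?oppr_ge0 // ler0_norm // sub0r opprK add0r mul0r.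
  by rewrite max_r ?oppr_le0 ?ltW // gtr0_norm // subr0 addr0 mulr0.
set x := \sum_i P i; set y := \sum_i Q i.
have -> : (\sum_i `|n i|) = x + y.
  by rewrite -big_split; apply: eq_bigr => i _; case: (PQ i).
have -> : (\sum_i n i) = x - y.
  by rewrite -sumrB; apply: eq_bigr => i _; case: (PQ i).
have -> : K * ((x + y) ^+ 2 - (x - y) ^+ 2) = 4 * (K * (x * y)) by ring.
rewrite ler_pM2l ?ltr0n //.
set k := \sum_i P i * s i.
have kE : k = \sum_i Q i * s i.
  apply/eqP; rewrite -subr_eq0 -sumrB; apply/eqP; rewrite -[RHS]ns0.
  by apply: eq_bigr => i _; rewrite -mulrBl; case: (PQ i) => <-.
have Px i : P i <= x by rewrite /x (bigD1 i) //= lerDl sumr_ge0.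
have Qy i : Q i <= y by rewrite /y (bigD1 i) //= lerDl sumr_ge0.
apply: (@le_trans _ _ (x * k + y * k)).
  rewrite {2}kE /k !mulr_sumr -big_split /=; apply: ler_sum => i _.
  have [-> _ PQ0] := PQ i.
  have -> : (P i - Q i) ^+ 2 * s i = P i * (P i * s i) + Q i * (Q i * s i)
            - 2 * s i * (P i * Q i) by ring.
  by rewrite PQ0 mulr0 subr0 lerD // ler_wpM2r // mulr_ge0.
have -> : x * k + y * k = \sum_i \sum_j P i * Q j * (s i + s j).
  rewrite addrC {2}kE /k /x /y mulrC !mulr_suml -big_split /=.
  apply: eq_bigr => i _; rewrite !mulr_sumr -big_split /=; apply: eq_bigr => j _; ring.
rewrite /x /y mulr_suml mulr_sumr; apply: ler_sum => i _.
rewrite !mulr_sumr; apply: ler_sum => j _; rewrite [leRHS]mulrC.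
(* The bound [K] is available only for distinct indices; on the diagonal [P i * Q i = 0] makes the
   term vanish. *)
have [<-|ij] := eqVneq i j; first by case: (PQ i) => _ _ ->; rewrite !mul0r.
by rewrite ler_wpM2l ?mulr_ge0 // sK.
Qed.

(** Enumerating [I] turns the families into row vectors, to which Cauchy-Schwarz for [dotmx]
    applies. *)
Lemma sum_CauchySchwarz (C : numClosedFieldType) (I : finType) (f g : I -> C) :
  `|\sum_i f i * (g i)^*%R| ^+ 2 <= (\sum_i `|f i| ^+ 2) * (\sum_i `|g i| ^+ 2).
Proof.
pose r (h : I -> C) : 'rV_#|I| := \row_j h (enum_val j).
have rE (h k : I -> C) : dotmx (r h) (r k) = \sum_i h i * (k i)^*%R.
  rewrite dotmxE mxE [RHS]big_enum_val /=.
  by apply: eq_bigr => j _; rewrite !mxE.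
have /= [le_fg _] := CauchySchwarz (@dotmx C _) (r f) (r g).
move: le_fg; rewrite !rE => /le_trans; apply.
by rewrite le_eqVlt; apply/orP; left; apply/eqP; congr (_ * _);
   apply: eq_bigr => i _; rewrite normCK.
Qed.

(** * Adjoints, and real and imaginary parts of sums *)

Lemma hermsymmxP (C : numClosedFieldType) (d : nat) (A : 'M[C]_d) :
  reflect (A ^t* = A) (A \is hermsymmx).
Proof.
by apply: (iffP (is_hermitianmxP _ _ _)); rewrite expr0 scale1r.
Qed.

Lemma adjmxM (C : numClosedFieldType) (m n p : nat) (A : 'M[C]_(m, n))
    (B : 'M_(n, p)) :
  (A *m B) ^t* = B ^t* *m A ^t*.
Proof. by rewrite trmx_mul map_mxM. Qed.

Lemma adjmxB (C : numClosedFieldType) (m n : nat) (A B : 'M[C]_(m, n)) :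
  (A - B) ^t* = A ^t* - B ^t*.
Proof. by rewrite linearB /= map_mxB. Qed.

Lemma adjmxD (C : numClosedFieldType) (m n : nat) (A B : 'M[C]_(m, n)) :
  (A + B) ^t* = A ^t* + B ^t*.
Proof. by rewrite linearD /= map_mxD. Qed.

Lemma adjmxZ (C : numClosedFieldType) (m n : nat) (c : C) (A : 'M[C]_(m, n)) :
  (c *: A) ^t* = c^*%R *: A ^t*.
Proof. by rewrite linearZ /= map_mxZ. Qed.

Lemma adj_diag_mx (C : numClosedFieldType) (d : nat) (v : 'rV[C]_d) :
  (diag_mx v) ^t* = diag_mx (map_mx Num.conj v).
Proof. by rewrite tr_diag_mx map_diag_mx. Qed.

Lemma Re_sum (R : realType) (I : finType) (f : I -> R[i]) :
  complex.Re (\sum_i f i) = \sum_i complex.Re (f i).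
Proof. by elim/big_rec2: _ => //= i x y _ <-; case: (f i) y => [? ?] [? ?]. Qed.

Lemma Im_sum (R : realType) (I : finType) (f : I -> R[i]) :
  complex.Im (\sum_i f i) = \sum_i complex.Im (f i).
Proof. by elim/big_rec2: _ => //= i x y _ <-; case: (f i) y => [? ?] [? ?]. Qed.

(** * Gram determinants and commutators *)

(* Cauchy-Schwarz for the rows of [T *m A] and [T *m B], after conjugating the
   rows whose contribution to [\tr (A *m B *m (T ^t* *m T))] has negative
   imaginary part, so that these imaginary parts add up in absolute value. *)
Lemma gram_deficit (R : realType) (d : nat) (T A B : 'M[R[i]]_d)
    (rho := T ^t* *m T) (x := fun k => complex.Im ((T *m A *m B *m T ^t*) k k)) :
  A \is hermsymmx -> B \is hermsymmx ->
  ((\sum_k `|x k|) ^+ 2 - (\sum_k x k) ^+ 2)%:C + `|\tr (A *m B *m rho)| ^+ 2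
    <= \tr (A *m A *m rho) * \tr (B *m B *m rho).
Proof.
move=> /hermsymmxP hA /hermsymmxP hB.
have trE (M N : 'M_d) : N ^t* = N ->
    \tr (M *m N *m rho) = \sum_k \sum_i (T *m M) k i * ((T *m N) k i)^*%R.
  move=> hN; rewrite /rho mulmxA mxtrace_mulC !mulmxA.
  have -> : T *m M *m N *m T^t* = (T *m M) *m (T *m N)^t*.
    by rewrite adjmxM hN !mulmxA.
  by apply: eq_bigr => k _; rewrite mxE; apply: eq_bigr => i _; rewrite !mxE.
pose z k := (T *m A *m B *m T ^t*) k k.
have zE k : z k = \sum_i (T *m A) k i * ((T *m B) k i)^*%R.
  have -> : z k = ((T *m A) *m (T *m B)^t*) k k by rewrite adjmxM hB !mulmxA.
  by rewrite mxE; apply: eq_bigr => i _; rewrite !mxE.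
have -> : \tr (A *m B *m rho) = \sum_k z k.
  by rewrite trE //; apply: eq_bigr => k _; rewrite zE.
rewrite -add_Re2_Im2 Re_sum Im_sum -rmorphD /= -/z.
set r := \sum_k complex.Re _; set t := \sum_k complex.Im _.
have -> : (\sum_k `|x k|) ^+ 2 - (\sum_k x k) ^+ 2 + (r ^+ 2 + t ^+ 2)
        = r ^+ 2 + (\sum_k `|x k|) ^+ 2.
  have -> : \sum_k x k = t by [].
  ring.
pose c k (w : R[i]) := if 0 <= x k then w else w^*%R.
pose f (M : 'M_d) (p : 'I_d * 'I_d) := c p.1 ((T *m M) p.1 p.2).
have normf (M : 'M_d) p : `|f M p| = `|(T *m M) p.1 p.2|.
  by rewrite /f /c; case: ifP => // _; rewrite norm_conjC.
have sumf (M : 'M_d) : M ^t* = M -> \tr (M *m M *m rho) = \sum_p `|f M p| ^+ 2.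
  move=> hM; rewrite trE // pair_bigA; apply: eq_bigr => -[k i] _.
  by rewrite normf normCK.
rewrite !sumf //; have := sum_CauchySchwarz (f A) (f B).
(* The twist [c k] keeps real parts and makes imaginary parts nonnegative, so the inner product of
   [f A] and [f B] has real part [r] and imaginary part [\sum_k |x k|]. *)
suff -> : \sum_p f A p * (f B p)^*%R = \sum_k c k (z k).
  apply: le_trans; rewrite -add_Re2_Im2 Re_sum Im_sum.
  have -> : \sum_k complex.Re (c k (z k)) = r.
    by apply: eq_bigr => k _; rewrite /c; case: ifP => // _; case: (z k).
  have -> : \sum_k complex.Im (c k (z k)) = \sum_k `|x k|.
    apply: eq_bigr => k _; rewrite /c /x -/(z k); case: ifPn => [k0|].
      by rewrite ger0_norm.
    by rewrite -ltNge => k0; rewrite ltr0_norm //; case: (z k).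
  by [].
have -> : \sum_p f A p * (f B p)^*%R = \sum_k \sum_i f A (k, i) * (f B (k, i))^*%R.
  by rewrite pair_bigA; apply: eq_bigr => -[].
apply: eq_bigr => k _; rewrite zE /f /c /=; case: ifP => // _.
by rewrite rmorph_sum; apply: eq_bigr => i _; rewrite rmorphM.
Qed.

(** With [Ti] the inverse of [T], cyclicity of the trace turns [\tr C = 0] and [\tr (C^* C rho)]
    into sums weighted by the diagonal [s] of [Ti^* Ti]. These are the hypothesis and the left-hand
    side of [weighted_sum_sqr_le], whose right-hand side is controlled by [gram_deficit]. *)
Lemma commmx_gram_bound (R : realType) (d : nat) (T Ti A B : 'M[R[i]]_d)
    (e : 'rV[R[i]]_d) (s : 'I_d -> R) (K : R) (rho := T ^t* *m T) :
  A \is hermsymmx -> B \is hermsymmx -> Ti *m T = 1%:M ->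
  T *m commmx A B *m T ^t* = diag_mx e ->
  (forall k, (Ti ^t* *m Ti) k k = (s k)%:C) -> (forall k, 0 <= s k) ->
  (forall i j, i != j -> s i + s j <= K) -> 0 <= K ->
  \tr (sqabsmx (commmx A B) *m rho) <=
    K%:C * (\tr (A *m A *m rho) * \tr (B *m B *m rho)
            - `|\tr (A *m B *m rho)| ^+ 2).
Proof.
move=> hA hB TiT TCT sE s_ge0 sK K0.
have /hermsymmxP hA' := hA; have /hermsymmxP hB' := hB.
have TTi : T *m Ti = 1%:M by apply: mulmx1C.
have TaTia : T^t* *m Ti^t* = 1%:M by rewrite -adjmxM TiT trmx1 map_mx1.
set C := commmx A B in TCT *.
pose x k := complex.Im ((T *m A *m B *m T ^t*) k k).
have eE k : e 0 k = (2 * x k)%:C * 'i%C.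
  have -> : e 0 k = (T *m C *m T^t*) k k by rewrite TCT mxE eqxx mulr1n.
  rewrite /C /commmx mulmxBr mulmxBl !mulmxA.
  have -> : T *m B *m A *m T^t* = (T *m A *m B *m T^t*)^t*.
    by rewrite !adjmxM trmxCK hA' hB' !mulmxA.
  rewrite /x; set Z := T *m A *m B *m T^t*.
  by rewrite !mxE rmorphM /= rmorph_nat; exact: subcJ.
have TC : T *m C = diag_mx e *m Ti^t*.
  by rewrite -TCT -!mulmxA TaTia mulmx1.
have CTa : C *m T^t* = Ti *m diag_mx e.
  by rewrite -TCT !mulmxA TiT mul1mx.
have xs0 : \sum_k x k * s k = 0.
  have : \tr C = 0 by rewrite /C /commmx linearB /= mxtrace_mulC subrr.
  have -> : C = Ti *m (diag_mx e *m Ti^t*) by rewrite -TC mulmxA TiT mul1mx.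
  rewrite mxtrace_mulC -mulmxA mul_diag_mx.
  rewrite (_ : \tr _ = (2 * \sum_k x k * s k)%:C * 'i%C); last first.
    rewrite mulr_sumr rmorph_sum mulr_suml; apply: eq_bigr => k _.
    by rewrite mxE eE sE mulrA !rmorphM /=; ring.
  move=> /eqP; rewrite mulf_eq0 => /orP[|/eqP[]/eqP]; last by rewrite oner_eq0.
  by move=> /eqP[] /eqP; rewrite mulf_eq0 pnatr_eq0 /= => /eqP.
have -> : \tr (sqabsmx C *m rho) = (4 * \sum_k x k ^+ 2 * s k)%:C.
  (* A commutator of Hermitian matrices is anti-Hermitian; the sign cancels below against the square
     of ['i] coming from two factors [e]. *)
  have -> : sqabsmx C = - (C *m C).
    by rewrite /sqabsmx {1}/C /commmx adjmxB !adjmxM hA' hB' -opprB mulNmx.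
  rewrite /rho mulNmx mulmxA linearN /= mxtrace_mulC !mulmxA TC.
  rewrite -!mulmxA CTa mulmxA mulmxA -(mulmxA (diag_mx e)).
  rewrite mulr_sumr rmorph_sum -sumrN; apply: eq_bigr => k _.
  rewrite mul_mx_diag mxE mul_diag_mx mxE eE sE.
  have -> : (2 * x k)%:C * 'i%C * (s k)%:C * ((2 * x k)%:C * 'i%C)
    = (2 * x k)%:C ^+ 2 * (s k)%:C * 'i%C ^+ 2 by ring.
  by rewrite sqr_i mulrN1 opprK -rmorphXn -rmorphM /=; congr (_%:C); ring.
apply: le_trans (_ : _ <= (K * ((\sum_k `|x k|) ^+ 2 - (\sum_k x k) ^+ 2))%:C) _.
  by rewrite lecR; apply: weighted_sum_sqr_le.
rewrite rmorphM /=; apply: ler_wpM2l; first by rewrite ler0c.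
by rewrite lerBrDr; apply: gram_deficit.
Qed.

(** * Diagonal forms and ordered eigenvalues *)

Definition real_diag_mx (R : realType) (d : nat) (p : 'I_d -> R) : 'M[R[i]]_d :=
  diag_mx (\row_i (p i)%:C).

Lemma real_diag_mxM (R : realType) (d : nat) (p q : 'I_d -> R) :
  real_diag_mx p *m real_diag_mx q = real_diag_mx (fun i => p i * q i).
Proof.
by rewrite mulmx_diag; congr diag_mx; apply/rowP => i; rewrite !mxE -rmorphM.
Qed.

Lemma adj_real_diag_mx (R : realType) (d : nat) (p : 'I_d -> R) :
  (real_diag_mx p) ^t* = real_diag_mx p.
Proof.
rewrite adj_diag_mx; congr diag_mx; apply/rowP => i; rewrite !mxE.
exact: conjc_real.
Qed.

Lemma real_diag_mx1 (R : realType) (d : nat) (p : 'I_d -> R) :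
  (forall i, p i = 1) -> real_diag_mx p = 1%:M.
Proof.
move=> p1; rewrite -diag_const_mx; congr diag_mx.
by apply/rowP => i; rewrite !mxE p1.
Qed.

Lemma char_poly_conj (F : comUnitRingType) (d : nat) (P Q A : 'M[F]_d) :
  P *m Q = 1%:M -> char_poly (P *m A *m Q) = char_poly A.
Proof.
move=> PQ; pose toP (M : 'M_d) := map_mx (@polyC F) M.
have PQ' : toP P *m toP Q = 1%:M by rewrite /toP -map_mxM PQ map_mx1.
rewrite /char_poly /char_poly_mx !map_mxM -!/(toP _).
have -> : 'X%:M - toP P *m toP A *m toP Q = toP P *m ('X%:M - toP A) *m toP Q.
  by rewrite mulmxBr mulmxBl scalar_mxC -(mulmxA _ (toP P)) PQ' mulmx1.
by rewrite !det_mulmx mulrAC -det_mulmx PQ' det1 mul1r.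
Qed.

(** Both lists split the same monic characteristic polynomial into linear factors, so they agree up
    to a permutation, which sorting removes. *)
Lemma eigenvalues_spectral_diag (R : realType) (d : nat) (rho : 'M[R[i]]_d) :
  rho \is hermsymmx ->
  eigenvalues rho =
    sort <=%R [seq complex.Re (spectral_diag rho 0 i) | i <- enum 'I_d].
Proof.
move=> /hermitian_normalmx /orthomx_spectralP rhoE.
rewrite /eigenvalues; case: closed_field_poly_normal => r /= rE.
apply/perm_sortP; [exact: le_total | exact: le_trans | exact: le_anti |].
rewrite (map_comp _ (spectral_diag rho 0)); apply/perm_map/prod_XsubC_eq.
move: rE; rewrite (monicP (char_poly_monic _)) scale1r => <-.
rewrite {1}rhoE char_poly_conj ?mulVmx ?spectral_unit //.
rewrite char_poly_trig ?diag_mx_is_trig // big_map big_enum /=.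
by apply: eq_bigr => i _; rewrite mxE eqxx.
Qed.

Lemma density_spectrum (R : realType) (d : nat) (rho : 'M[R[i]]_d) :
  (2 <= d)%N -> rho \is hermsymmx ->
  exists (U : 'M[R[i]]_d) (p : 'I_d -> R) (i0 i1 : 'I_d),
  [/\ U \is unitarymx, rho = U ^t* *m real_diag_mx p *m U, i0 != i1,
      p i0 = lambda1 rho /\ p i1 = lambda2 rho &
      lambda1 rho <= lambda2 rho /\
      forall i, i != i0 -> lambda2 rho <= p i].
Proof.
move=> d2 rhoH; pose p i := complex.Re (spectral_diag rho 0 i).
have Uu := spectral_unitarymx rho.
have rhoE : rho = (spectralmx rho)^t* *m real_diag_mx p *m spectralmx rho.
  have <- : diag_mx (spectral_diag rho) = real_diag_mx p.
    congr diag_mx; apply/rowP => i; rewrite mxE /p RRe_real //.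
    exact: mxOverP (hermitian_spectral_diag_real rhoH) _ _.
  by rewrite -invmx_unitary //; apply/orthomx_spectralP/hermitian_normalmx.
exists (spectralmx rho), p.
(* Sorting the indices by eigenvalue, instead of the eigenvalues, yields distinct [i0] and [i1] even
   when the two smallest eigenvalues coincide. *)
have := eigenvalues_spectral_diag rhoH; rewrite -/p sort_map.
set s := sort _ _ => eE.
have mem_s i : i \in s by rewrite mem_sort mem_enum.
have : uniq s by rewrite sort_uniq enum_uniq.
have : sorted (relpre p <=%R) s by apply: sort_sorted => i j; apply: le_total.
have : size s = d by rewrite size_sort size_enum_ord.
case: s eE mem_s => [|i0 [|i1 s]] eE mem_s.
- by move=> d0; rewrite -d0 in d2.
- by move=> d0; rewrite -d0 in d2.
move=> _ /= /andP[le01 s_path] /andP[]; rewrite inE negb_or => /andP[i01 _] _.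
exists i0, i1; rewrite /lambda1 /lambda2 eE /=; split=> //; split=> // i.
have := mem_s i; rewrite !inE => /orP[->//|/orP[/eqP->//|si _]].
have le_tr : transitive (relpre p <=%R) by move=> x y z; apply: le_trans.
exact: (allP (order_path_min le_tr s_path)).
Qed.

(** * The bound for a positive spectrum *)

(* Ky Fan's bound on [\tr (rho^-1 *m tau)] for [0 <= tau <= 1] of trace 2, in the
   eigenbasis of [rho]; [q] is the diagonal of [tau]. *)
Lemma weighted_sum_inv_le (F : realFieldType) (I : finType) (p q : I -> F)
    (i0 : I) (b : F) :
  0 < p i0 -> p i0 <= b -> (forall i, i != i0 -> b <= p i) ->
  (forall i, 0 <= q i) -> q i0 <= 1 -> \sum_i q i = 2 ->
  \sum_i q i / p i <= (p i0)^-1 + b^-1.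
Proof.
move=> a0 ab bp q0 q1 q2; set a := p i0 in a0 ab *.
have b0 : 0 < b by apply: lt_le_trans ab.
apply: (@le_trans _ _ (q i0 / a + (2 - q i0) / b)).
  rewrite (bigD1 i0) //= lerD2l.
  have -> : 2 - q i0 = \sum_(i | i != i0) q i.
    by rewrite -q2 (bigD1 i0) //= addrC addrK.
  rewrite mulr_suml; apply: ler_sum => i /bp bpi; apply: ler_wpM2l => //.
  by rewrite lef_pV2 // posrE // (lt_le_trans b0).
rewrite -subr_ge0.
have -> : a^-1 + b^-1 - (q i0 / a + (2 - q i0) / b)
          = (1 - q i0) * (a^-1 - b^-1) by ring.
by rewrite mulr_ge0 // subr_ge0 // lef_pV2.
Qed.

Lemma mulmx_adj_diag (R : realType) (m d : nat) (V : 'M[R[i]]_(m, d))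
    (p : 'I_d -> R) (k : 'I_m) :
  (V *m real_diag_mx p *m V ^t*) k k =
    (\sum_i (complex.Re (V k i) ^+ 2 + complex.Im (V k i) ^+ 2) * p i)%:C.
Proof.
rewrite mxE rmorph_sum; apply: eq_bigr => i _.
by rewrite mul_mx_diag !mxE rmorphM /= add_Re2_Im2 normCK mulrAC.
Qed.

(** In use, [p i0] and [b] are the two smallest eigenvalues. Positivity of the spectrum makes [T]
    invertible, as [commmx_gram_bound] requires. *)
Lemma positive_gram_bound (R : realType) (d : nat) (U A B : 'M[R[i]]_d)
    (p : 'I_d -> R) (i0 : 'I_d) (b : R)
    (rho := U ^t* *m real_diag_mx p *m U) :
  U \is unitarymx -> A \is hermsymmx -> B \is hermsymmx ->
  0 < p i0 -> p i0 <= b -> (forall i, i != i0 -> b <= p i) ->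
  \tr (sqabsmx (commmx A B) *m rho) <=
    ((p i0)^-1 + b^-1)%:C * (\tr (A *m A *m rho) * \tr (B *m B *m rho)
            - `|\tr (A *m B *m rho)| ^+ 2).
Proof.
move=> Uu hA hB a0 ab bp.
have b0 : 0 < b by apply: lt_le_trans ab.
have p0 i : 0 < p i by have [->//|/bp] := eqVneq i i0; apply: lt_le_trans.
have UUa : U *m U^t* = 1%:M by apply/unitarymxP.
have UaU : U^t* *m U = 1%:M by apply: mulmx1C.
(* Here [D] is the square root of the eigenvalue matrix and [Di] is its inverse. *)
have [D [Di [Da Dia DD DiDi DiD]]] : exists D Di : 'M[R[i]]_d,
    [/\ D^t* = D, Di^t* = Di, D *m D = real_diag_mx p,
        Di *m Di = real_diag_mx (fun i => (p i)^-1) & Di *m D = 1%:M].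
  exists (real_diag_mx (fun i => Num.sqrt (p i))).
  exists (real_diag_mx (fun i => (Num.sqrt (p i))^-1)).
  rewrite !adj_real_diag_mx !real_diag_mxM; split=> //.
  - congr diag_mx; apply/rowP => i.
    by rewrite !mxE -expr2 sqr_sqrtr // ltW.
  - congr diag_mx; apply/rowP => i.
    by rewrite !mxE -invfM -expr2 sqr_sqrtr // ltW.
  - by rewrite real_diag_mx1 // => i; rewrite mulVf // sqrtr_eq0 -ltNge.
(* The matrix to be diagonalized is anti-Hermitian, hence normal, so the spectral theorem gives a
   unitary [V]. *)
have [V [e [Vu NE]]] : exists (V : 'M[R[i]]_d) (e : 'rV[R[i]]_d),
    V \is unitarymx /\
    D *m U *m commmx A B *m U^t* *m D = V^t* *m diag_mx e *m V.
  set N := _ *m D.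
  exists (spectralmx N), (spectral_diag N); have Vu := spectral_unitarymx N.
  split=> //; rewrite -invmx_unitary //; apply/orthomx_spectralP/normalmxP.
  suff -> : N^t* = - N by rewrite mulmxN mulNmx.
  have /hermsymmxP hA' := hA; have /hermsymmxP hB' := hB.
  have Ca : (commmx A B)^t* = - commmx A B.
    by rewrite /commmx adjmxB !adjmxM hA' hB' opprB.
  by rewrite /N !adjmxM Da Ca trmxCK mulNmx !mulmxN !mulmxA.
have VVa : V *m V^t* = 1%:M by apply/unitarymxP.
have VaV : V^t* *m V = 1%:M by apply: mulmx1C.
pose T := V *m D *m U; pose Ti := U^t* *m Di *m V^t*.
have -> : rho = T^t* *m T.
  by rewrite /T !adjmxM Da !mulmxA -(mulmxA _ _ V) VaV mulmx1 -(mulmxA _ D D) DD.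
(* The squared moduli of the entries of the unitary [V], taken in [R], form a doubly stochastic
   matrix. *)
pose w k i := complex.Re (V k i) ^+ 2 + complex.Im (V k i) ^+ 2.
have w0 k i : 0 <= w k i by rewrite addr_ge0 ?sqr_ge0.
have wE k i : (w k i)%:C = V k i * (V k i)^*%R by rewrite add_Re2_Im2 normCK.
have w_row k : \sum_i w k i = 1.
  apply: (@complexI R); rewrite rmorph_sum rmorph1 /=.
  have /matrixP /(_ k k) := VVa; rewrite !mxE eqxx mulr1n => <-.
  by apply: eq_bigr => i _; rewrite wE !mxE.
have w_col i : \sum_k w k i = 1.
  apply: (@complexI R); rewrite rmorph_sum rmorph1 /=.
  have /matrixP /(_ i i) := VaV; rewrite !mxE eqxx mulr1n => <-.
  by apply: eq_bigr => k _; rewrite wE !mxE mulrC.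
apply: (@commmx_gram_bound _ _ T Ti A B e
          (fun k => \sum_i w k i / p i)) => //.
- rewrite /Ti /T !mulmxA -(mulmxA _ _ V) VaV mulmx1 -(mulmxA _ Di) DiD mulmx1 //.
- have -> : T *m commmx A B *m T^t*
            = V *m (D *m U *m commmx A B *m U^t* *m D) *m V^t*.
    by rewrite /T !adjmxM Da !mulmxA.
  by rewrite NE !mulmxA VVa mul1mx -mulmxA VVa mulmx1.
- move=> k; rewrite -mulmx_adj_diag -DiDi /Ti !adjmxM trmxCK Dia trmxCK.
  by rewrite !mulmxA -(mulmxA _ U) UUa mulmx1.
- by move=> k; apply: sumr_ge0 => i _; rewrite divr_ge0 // ltW.
(* Two distinct rows of [w] have total weight 2, and their joint weight at [i0] is at most the
   column sum 1; this is the situation of [weighted_sum_inv_le]. *)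
- move=> j k jk; rewrite -big_split /=.
  rewrite (eq_bigr (fun i => (w j i + w k i) / p i)); last first.
    by move=> i _; rewrite [RHS]mulrDl.
  apply: weighted_sum_inv_le => //.
  + by move=> i; rewrite addr_ge0.
  + rewrite -(w_col i0) (bigD1 j) //= lerD2l (bigD1 k) 1?eq_sym //=.
    by rewrite lerDl sumr_ge0.
  + by rewrite big_split /= !w_row.
- by rewrite addr_ge0 // invr_ge0 ltW.
Qed.

(** * Reduction to centred matrices *)

Lemma adj_scalar_mx (C : numClosedFieldType) (d : nat) (a : C) :
  (a%:M : 'M_d) ^t* = (a^*%R)%:M.
Proof. by rewrite tr_scalar_mx map_scalar_mx. Qed.

Lemma conj_mxtrace_mul (C : numClosedFieldType) (d : nat) (X rho : 'M[C]_d) :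
  rho ^t* = rho -> (\tr (X *m rho))^*%R = \tr (X ^t* *m rho).
Proof.
move=> rhoH; rewrite -[in RHS]rhoH mxtrace_mulC -adjmxM rmorph_sum.
by apply: eq_bigr => i _; rewrite !mxE.
Qed.

Lemma conj_mxtrace_mul2 (C : numClosedFieldType) (d : nat) (X Y rho : 'M[C]_d) :
  X ^t* = X -> Y ^t* = Y -> rho ^t* = rho ->
  (\tr (X *m Y *m rho))^*%R = \tr (Y *m X *m rho).
Proof. by move=> XH YH rhoH; rewrite conj_mxtrace_mul // adjmxM XH YH. Qed.

(** The two terms are the squares of the imaginary and real parts of [z]. *)
Lemma normC2_add_conj (C : numClosedFieldType) (z : C) :
  4^-1 * `|z - z^*%R| ^+ 2 + (2^-1 * (z + z^*%R)) ^+ 2 = `|z| ^+ 2.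
Proof. by rewrite !normCK rmorphB /= conjCK; field. Qed.

Lemma mxtrace_shift_mul (F : comNzRingType) (d : nat) (X Y rho : 'M[F]_d)
    (x y : F) :
  \tr ((X - x%:M) *m (Y - y%:M) *m rho) =
    \tr (X *m Y *m rho) - y * \tr (X *m rho)
    - x * (\tr (Y *m rho) - y * \tr rho).
Proof.
have trB (M N : 'M[F]_d) : \tr (M - N) = \tr M - \tr N by exact: raddfB.
rewrite mulmxBl mul_scalar_mx mulmxBr mul_mx_scalar !mulmxBl -!scalemxAl mulmxBl.
by rewrite mul_scalar_mx !(trB, mxtraceZ).
Qed.

Lemma comm_shift_mx (F : comNzRingType) (d : nat) (X Y : 'M[F]_d) (x y : F) :
  (X - x%:M) *m (Y - y%:M) - (Y - y%:M) *m (X - x%:M) = X *m Y - Y *m X.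
Proof.
rewrite !mulmxBl !mulmxBr !mul_scalar_mx !mul_mx_scalar.
by apply/matrixP => i j; rewrite !mxE mulrnAr mulrnAr (mulrC y x); ring.
Qed.

Definition centered_mx (R : realType) (d : nat) (rho X : 'M[R[i]]_d) : 'M[R[i]]_d :=
  X - (expect rho X)%:M.

Lemma centered_mx_herm (R : realType) (d : nat) (rho X : 'M[R[i]]_d) :
  rho \is hermsymmx -> X \is hermsymmx -> centered_mx rho X \is hermsymmx.
Proof.
move=> /hermsymmxP rhoH /hermsymmxP XH; apply/hermsymmxP.
by rewrite adjmxB XH adj_scalar_mx (conj_mxtrace_mul _ rhoH) XH.
Qed.

Lemma commmx_center (R : realType) (d : nat) (rho A B : 'M[R[i]]_d) :
  commmx (centered_mx rho A) (centered_mx rho B) = commmx A B.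
Proof. exact: comm_shift_mx. Qed.

(** For [z] the expectation of [A0 *m B0], the commutator has mean [z - z^*] and the covariance is
    the real part of [z]; their two terms merge into the squared modulus of [z]. *)
Lemma uncertainty_boundE (R : realType) (d : nat) (rho A B : 'M[R[i]]_d) (b : R)
    (A0 := centered_mx rho A) (B0 := centered_mx rho B) :
  A \is hermsymmx -> B \is hermsymmx -> density rho ->
  uncertainty_bound rho b A B <->
  b%:C * \tr (sqabsmx (commmx A B) *m rho) <=
    \tr (A0 *m A0 *m rho) * \tr (B0 *m B0 *m rho)
    - `|\tr (A0 *m B0 *m rho)| ^+ 2.
Proof.
move=> hA hB [[rhoH _] rho1].
have /hermsymmxP hA' := hA; have /hermsymmxP hB' := hB.
have /hermsymmxP hA0 := centered_mx_herm rhoH hA.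
have /hermsymmxP hB0 := centered_mx_herm rhoH hB.
rewrite /uncertainty_bound /variance.
rewrite -/(centered_mx rho A) -/(centered_mx rho B) -/A0 -/B0.
pose z := expect rho (A0 *m B0).
have zC : z^*%R = expect rho (B0 *m A0).
  by apply: conj_mxtrace_mul2 => //; apply/hermsymmxP.
have commE : expect rho (commmx A B) = z - z^*%R.
  by rewrite -(commmx_center rho) zC /z /expect /commmx -/A0 -/B0 mulmxBl linearB.
have prodE (X Y : 'M_d) : expect rho (centered_mx rho X *m centered_mx rho Y)
    = expect rho (X *m Y) - expect rho X * expect rho Y.
  rewrite {1}/expect mxtrace_shift_mul rho1 -/(expect rho _).
  by rewrite -/(expect rho X) -/(expect rho Y) mulr1 subrr mulr0 subr0 mulrC.
have covE : covariance rho A B = 2^-1 * (z + z^*%R).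
  rewrite zC /z !prodE /covariance /acommmx {1}/expect mulmxDl mxtraceD.
  rewrite -/(expect rho (A *m B)) -/(expect rho (B *m A)).
  move: (expect rho _) (expect rho _) (expect rho _) (expect rho _) => p q r t.
  by field.
by rewrite commE covE normC2_add_conj addrC -lerBrDr.
Qed.

(** * The inequality for every density matrix *)

(** The triangle inequality makes the lower bound in [gram_deficit] nonnegative. *)
Lemma gram_ge0 (R : realType) (d : nat) (T A B : 'M[R[i]]_d)
    (rho := T ^t* *m T) :
  A \is hermsymmx -> B \is hermsymmx ->
  0 <= \tr (A *m A *m rho) * \tr (B *m B *m rho) - `|\tr (A *m B *m rho)| ^+ 2.
Proof.
move=> hA hB; have := gram_deficit T hA hB; rewrite -lerBrDr; apply: le_trans.
by rewrite ler0c subr_ge0 -[leLHS]real_normK ?num_real // lerXn2r ?nnegrE ?sumr_ge0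
           ?ler_norm_sum.
Qed.

(** Testing the quadratic form on an eigenvector transfers positivity, weak or strict, from the
    matrix to its eigenvalues. *)
Lemma psd_diag_quad (R : realType) (d : nat) (U : 'M[R[i]]_d) (p : 'I_d -> R)
    (i : 'I_d) (u := U ^t* *m delta_mx i 0 : 'cV_d) :
  U \is unitarymx ->
  u != 0 /\ (u ^t* *m (U ^t* *m real_diag_mx p *m U) *m u) 0 0 = (p i)%:C.
Proof.
move=> /unitarymxP UUa.
have Uu : U *m u = delta_mx i 0 by rewrite mulmxA UUa mul1mx.
split.
  apply/eqP => u0; have /matrixP /(_ i 0) := Uu.
  by rewrite u0 mulmx0 !mxE !eqxx /= => /eqP; rewrite eq_sym oner_eq0.
clearbody u; rewrite !mulmxA -(mulmxA _ U) Uu -adjmxM Uu -mulmxA mul_diag_mx.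
rewrite !mxE (bigD1 i) //=.
rewrite !mxE !eqxx /= conjC1 mul1r mulr1 big1 ?addr0 // => j ji.
by rewrite !mxE (negPf ji) /= mulr0 mulr0.
Qed.

Lemma density_uncertainty_bound (R : realType) (d : nat) (A B rho : 'M[R[i]]_d) :
  (2 <= d)%N -> A \is hermsymmx -> B \is hermsymmx -> density rho ->
  uncertainty_bound rho (uncertainty_coef rho) A B.
Proof.
move=> d2 hA hB rhoD; apply/uncertainty_boundE => //.
have [[rhoH rho_ge0] _] := rhoD.
have [U [p [i0 [i1 [Uu rhoE i01 [p0 p1] [l01 pi]]]]]] := density_spectrum d2 rhoH.
have p_ge0 i : 0 <= p i.
  have [_ quadE] := psd_diag_quad p i Uu.
  by move: (rho_ge0 (U^t* *m delta_mx i 0)); rewrite rhoE quadE ler0c.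
rewrite -(commmx_center rho).
have hA0 := centered_mx_herm rhoH hA; have hB0 := centered_mx_herm rhoH hB.
move: (centered_mx rho A) (centered_mx rho B) hA0 hB0 => {hA hB}A {}B hA hB.
rewrite /uncertainty_coef -p0 -p1; move: l01 pi; rewrite -p0 -p1 => l01 pi.
(* A zero eigenvalue makes the coefficient vanish, and nonnegativity of the Gram determinant
   suffices. *)
have [p00|p00] := eqVneq (p i0) 0.
  rewrite p00 !mul0r.
  have [T ->] : exists T : 'M[R[i]]_d, rho = T^t* *m T.
    exists (real_diag_mx (fun i => Num.sqrt (p i)) *m U).
    rewrite adjmxM adj_real_diag_mx mulmxA.
    rewrite -(mulmxA _ (real_diag_mx _) (real_diag_mx _)).
    rewrite real_diag_mxM rhoE; congr (_ *m _ *m _); congr diag_mx.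
    by apply/rowP => i; rewrite !mxE -expr2 sqr_sqrtr.
  exact: gram_ge0.
have p0_gt0 : 0 < p i0 by rewrite lt_neqAle eq_sym p00 p_ge0.
have p1_gt0 : 0 < p i1 by apply: lt_le_trans l01.
have := positive_gram_bound Uu hA hB p0_gt0 l01 pi; rewrite -rhoE => bound.
(* The coefficient is the inverse of [(p i0)^-1 + (p i1)^-1], so multiplying [bound] by it isolates
   the Gram determinant. *)
have c_ge0 : 0 <= (p i0 * p i1 / (p i0 + p i1))%:C.
  by rewrite ler0c divr_ge0 ?mulr_ge0 ?addr_ge0.
apply: le_trans (ler_wpM2l c_ge0 bound) _.
rewrite mulrA -rmorphM.
have -> : p i0 * p i1 / (p i0 + p i1) * ((p i0)^-1 + (p i1)^-1) = 1.
  by field; rewrite !gt_eqF ?addr_gt0.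
by rewrite mul1r.
Qed.

(** * Optimality of the coefficient *)

(* The Pauli matrices [sigma_x] and [sigma_y] on the span of the eigenvectors of
   [lambda1] and [lambda2] turn the inequality into an equality. *)
Lemma uncertainty_coef_optimal (R : realType) (d : nat) (rho : 'M[R[i]]_d)
    (b : R) :
  (2 <= d)%N -> density rho -> pdmx rho ->
  (forall A B : 'M[R[i]]_d, A \is hermsymmx -> B \is hermsymmx ->
     uncertainty_bound rho b A B) ->
  b <= uncertainty_coef rho.
Proof.
move=> d2 rhoD [rhoH rho_gt0] boundP.
have [U [p [i0 [i1 [Uu rhoE i01 [p0 p1] _]]]]] := density_spectrum d2 rhoH.
have p_gt0 i : 0 < p i.
  have [u_neq0 quadE] := psd_diag_quad p i Uu.
  by move: (rho_gt0 _ u_neq0); rewrite rhoE quadE ltcR.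
have UUa : U *m U^t* = 1%:M by apply/unitarymxP.
(* [f] carries a matrix written in the eigenbasis of [rho] back to the original basis, so test
   matrices can be given by matrix units. *)
pose f (M : 'M[R[i]]_d) := U^t* *m M *m U.
have fM (M N : 'M_d) : f M *m f N = f (M *m N).
  by rewrite /f !mulmxA -(mulmxA _ U) UUa mulmx1.
have fB (M N : 'M_d) : f M - f N = f (M - N) by rewrite /f mulmxBr mulmxBl.
have f_adj (M : 'M_d) : (f M)^t* = f (M^t*) by rewrite /f !adjmxM trmxCK mulmxA.
have f_tr (M : 'M_d) : \tr (f M *m rho) = \sum_k M k k * (p k)%:C.
  rewrite rhoE fM /f -mulmxA mxtrace_mulC -mulmxA UUa mulmx1.
  by apply: eq_bigr => k _; rewrite mul_mx_diag !mxE.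
have f_trD (M : 'M_d) (x y : R) :
    (forall k, M k k = (if k == i0 then x%:C else if k == i1 then y%:C else 0)) ->
    \tr (f M *m rho) = (x * p i0 + y * p i1)%:C.
  move=> ME; rewrite f_tr (bigD1 i0) // (bigD1 i1) 1?eq_sym //= !ME eqxx.
  rewrite eq_sym (negPf i01) eqxx big1 ?addr0 ?rmorphD ?rmorphM //.
  by move=> k /andP[k0 k1]; rewrite ME (negPf k0) (negPf k1) mul0r.
have fZ (c : R[i]) (M : 'M_d) : f (c *: M) = c *: f M.
  by rewrite /f -scalemxAr -scalemxAl.
have fH (M : 'M_d) : M^t* = M -> f M \is hermsymmx.
  by move=> MH; apply/hermsymmxP; rewrite f_adj MH.
clearbody f.
pose E (i j : 'I_d) : 'M[R[i]]_d := delta_mx i j.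
have E_adj i j : (E i j)^t* = E j i.
  by apply/matrixP => k l; rewrite !mxE andbC conjC_nat.
pose X := E i0 i1 + E i1 i0; pose Y := 'i%C *: (E i1 i0 - E i0 i1).
have XH : X^t* = X by rewrite /X adjmxD !E_adj addrC.
have iC : ('i%C : R[i])^*%R = - 'i%C.
  by apply/eqP; rewrite eq_complex /= oppr0 !eqxx.
have YH : Y^t* = Y.
  by rewrite /Y adjmxZ iC adjmxB !E_adj scaleNr -scalerN opprB.
have i10 : i1 != i0 by rewrite eq_sym.
have EE := (mul_delta_mx_cond, eqxx, negPf i01, negPf i10, mulr0n, mulr1n).
have XX : X *m X = E i0 i0 + E i1 i1.
  by rewrite /X mulmxDl !mulmxDr /E !EE add0r addr0.
have YY : Y *m Y = E i0 i0 + E i1 i1.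
  rewrite /Y -scalemxAl -scalemxAr scalerA -expr2 sqr_i scaleN1r.
  by rewrite mulmxBl !mulmxBr /E !EE sub0r subr0 -opprD opprK addrC.
have XY : X *m Y = 'i%C *: (E i0 i0 - E i1 i1).
  by rewrite /Y -scalemxAr /X mulmxDl !mulmxBr /E !EE subr0 sub0r.
have YX : Y *m X = - (X *m Y).
  rewrite XY /Y -scalemxAl /X mulmxBl !mulmxDr /E !EE add0r addr0.
  by rewrite -scalerN opprB.
(* [W] plays the role of [sigma_z], and [P] is the projection onto the chosen plane; the commutator
   becomes [2 i W], of squared modulus [4 P]. *)
pose W := E i0 i0 - E i1 i1; pose P := E i0 i0 + E i1 i1.
have WH : W^t* = W by rewrite /W adjmxB !E_adj.
have WW : W *m W = P.
  by rewrite /W mulmxBl !mulmxBr /E !EE subr0 sub0r opprK.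
have CE : commmx (f X) (f Y) = 2%:R *: ('i%C *: f W).
  by rewrite /commmx !fM fB YX opprK XY -mulr2n -scaler_nat !fZ.
have sqE : sqabsmx (commmx (f X) (f Y)) = f (4%:R *: P).
  rewrite /sqabsmx CE -!fZ f_adj fM scalerA adjmxZ WH -scalemxAl -scalemxAr WW.
  rewrite scalerA; congr (f (_ *: _)); rewrite rmorphM /= iC rmorph_nat.
  have -> : (2 * - 'i%C) * (2 * 'i%C) = - (4 * 'i%C ^+ 2) :> R[i] by ring.
  by rewrite sqr_i mulrN1 opprK.
have diagX k : X k k = 0.
  rewrite !mxE; have [->|_] := eqVneq k i0; first by rewrite (negPf i01) addr0.
  by rewrite /= andbF addr0.
have diagY k : Y k k = 0.
  rewrite !mxE; have [->|_] := eqVneq k i0.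
    by rewrite (negPf i01) subr0 mulr0.
  by rewrite /= andbF subr0 mulr0.
(* A zero diagonal in the eigenbasis means zero expectation, so centring leaves both test matrices
   unchanged. *)
have centered (M : 'M_d) : (forall k, M k k = 0) -> centered_mx rho (f M) = f M.
  move=> M0; rewrite /centered_mx /expect (f_trD _ 0 0).
    by rewrite !mul0r addr0 (raddf0 (@scalar_mx R[i] d)) subr0.
  by move=> k; rewrite M0 !if_same.
have trP : \tr (f P *m rho) = (p i0 + p i1)%:C.
  rewrite (f_trD _ 1 1) ?mul1r // => k; rewrite !mxE !andbb.
  have [->|_] := eqVneq k i0; first by rewrite (negPf i01) addr0.
  by case: (k == i1); rewrite add0r.
have trW : \tr (f W *m rho) = (p i0 - p i1)%:C.
  rewrite (f_trD _ 1 (-1)) ?mul1r ?mulN1r // => k; rewrite !mxE !andbb.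
  have [->|_] := eqVneq k i0; first by rewrite (negPf i01) subr0.
  by case: (k == i1); rewrite sub0r ?rmorphN ?oppr0.
have := boundP _ _ (fH _ XH) (fH _ YH).
move=> /(uncertainty_boundE b (fH _ XH) (fH _ YH) rhoD).
rewrite (centered _ diagX) (centered _ diagY) sqE !fM XX YY XY !fZ.
rewrite -!scalemxAl !mxtraceZ trP trW.
rewrite -add_Re2_Im2 /= -(rmorph_nat (real_complex R)) -!rmorphM -rmorphB lecR.
move: (p_gt0 i0) (p_gt0 i1) => p0_gt0 p1_gt0.
(* Up to arrangement, [bound] says that [4 b (p i0 + p i1)] is at most [(p i0 + p i1)^2 - (p i0 - p
   i1)^2 = 4 p i0 p i1]. *)
rewrite /uncertainty_coef -p0 -p1 ler_pdivlMr ?addr_gt0 // => bound.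
lra.
Qed.

Theorem mainTheorem1 (R : realType) (d : nat) (hd : (2 <= d)%N) :
  (forall A B rho : 'M[R[i]]_d,
     A \is hermsymmx -> B \is hermsymmx -> density rho ->
     uncertainty_bound rho (uncertainty_coef rho) A B)
  /\
  (forall rho : 'M[R[i]]_d, density rho -> pdmx rho ->
     (forall A B : 'M[R[i]]_d, A \is hermsymmx -> B \is hermsymmx ->
        uncertainty_bound rho (uncertainty_coef rho) A B)
     /\
     (forall b : R,
        (forall A B : 'M[R[i]]_d, A \is hermsymmx -> B \is hermsymmx ->
           uncertainty_bound rho b A B) ->
        b <= uncertainty_coef rho)).
Proof.
split=> [A B rho hA hB rhoD|rho rhoD rho_gt0].
  exact: density_uncertainty_bound.
split=> [A B hA hB|b boundP]; first exact: density_uncertainty_bound.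
exact: uncertainty_coef_optimal.
Qed.
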